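(* Let $p$ be a natural number with $p \geq 5$, and put $h = \left[\frac{p}{24}\right]$ and $r = p - 24h$. Then $p$ is prime if and only if $$(p-5)! \equiv rh + \frac{r^2-1}{24} \pmod{p}.$$
   Context: For a real number $x$, $[x]$ denotes the integer part of $x$, i.e. the largest integer less than or equal to $x$. Here $\frac{r^2-1}{24}$ is the exact rational quotient (not a rounded integer division), and $x \equiv y \pmod p$ means that $x-y$ is an integer multiple of $p$; in particular the congruence does not hold when $\frac{r^2-1}{24}$ is not an integer. *)

(* Defs.v *)
From mathcomp Require Import all_boot all_order all_algebra.
Set Implicit Arguments.
Unset Strict Implicit.
Unset Printing Implicit Defensive.
Import GRing.Theory Num.Theory.
Local Open Scope ring_scope.

(* Congruence of rationals modulo p: the difference must be an integer multiple
   of p, so an integer is never congruent to a non-integer. *)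
Definition rat_congr (p : nat) (x y : rat) : Prop :=
  exists k : int, x - y = k%:~R * p%:R.

(* Main.v *)
Require Import Defs.
From mathcomp Require Import all_boot all_order all_algebra.
From mathcomp Require Import zify ring.
Import GRing.Theory Num.Theory.
Local Open Scope ring_scope.

(** Multiplying the congruence by 24 turns its right-hand side into
    [r (24 h + r) - 1 = r p - 1], so it says [24 (p - 5)! + 1 = p (24 k + r)]
    for some [k].  Modulo [p], [24 (p - 5)!] is [(p - 1)!], so Wilson's theorem
    characterises primality as [24 (p - 5)! + 1 = p m] for some [m]; since
    every unit modulo 24 is its own inverse, such an [m] is automatically
    congruent to [p], hence to [r], modulo 24. *)

Lemma inverse_mod24 (m n : nat) : (m * n = 1 %[mod 24] -> m = n %[mod 24])%N.
Proof.
(* All 576 pairs of residues are checked by computation. *)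
have units24 : all (fun a : nat => all (fun b : nat =>
    (a * b %% 24 == 1)%N ==> (a == b)) (iota 0 24)) (iota 0 24) by [].
rewrite -modnMm => mn1.
have /allP/(_ (m %% 24)%N) := units24; rewrite mem_iota ltn_mod => /(_ isT).
move=> /allP/(_ (n %% 24)%N); rewrite mem_iota ltn_mod => /(_ isT).
by rewrite mn1 => /eqP.
Qed.

Lemma Wilson_sub5 (p : nat) :
  (5 <= p)%N -> prime p = (p %| (24 * (p - 5)`!).+1)%N.
Proof.
move=> p_ge5; rewrite Wilson; last exact: leq_trans p_ge5.
have [n ->] : exists n : nat, p = n.+4.+1 by exists (p - 5)%N; lia.
have -> : (n.+4.+1 - 5 = n)%N by lia.
(* [(p-1)(p-2)(p-3)(p-4) = p (p^3 - 10 p^2 + 35 p - 50) + 24] at [p = n + 5] *)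
have -> : ((n.+4.+1.-1)`!.+1 =
           n.+4.+1 * ((n ^ 3 + 5 * n ^ 2 + 10 * n) * n`!) + (24 * n`!).+1)%N.
  rewrite /= !factS; move: n`! => f; lia.
by rewrite dvdn_addr ?dvdn_mulr.
Qed.

Lemma rat_congr_int (p : nat) (f h r : int) : r = p%:Z - 24%:Z * h ->
  rat_congr p f%:~R ((r * h)%:~R + ((r ^+ 2)%:~R - 1) / 24%:R) <->
  exists k : int, 24%:Z * f + 1 = p%:Z * (p%:Z + 24%:Z * k).
Proof.
move=> hr.
have diffE : f%:~R - ((r * h)%:~R + ((r ^+ 2)%:~R - 1) / 24%:R) =
    (24%:Z * f + 1 - p%:Z * r)%:~R / 24%:R :> rat.
  by rewrite hr; field.
rewrite /rat_congr diffE; split=> [[k kE] | [k kE]].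
  (* The shift by [h] comes from [24 k + r = p + 24 (k - h)]. *)
  exists (k - h); apply: (@intr_inj rat).
  have /(congr1 (fun x => x * 24%:R)) := kE; rewrite mulfVK // => E.
  have -> : 24%:Z * f + 1 = (24%:Z * f + 1 - p%:Z * r) + p%:Z * r by ring.
  by rewrite intrD E hr; ring.
exists (k + h); rewrite kE hr; by field.
Qed.

Theorem theorem3 (p : nat) (h r : int)
    (hp : (5 <= p)%N)
    (hh : h = Num.floor (p%:R / 24%:R : rat))
    (hr : r = p%:Z - 24%:Z * h) :
  prime p <->
  rat_congr p ((p - 5)`!)%:R ((r * h)%:~R + ((r ^+ 2)%:~R - 1) / 24%:R).
Proof.
rewrite Wilson_sub5 // [X in rat_congr p X]pmulrn rat_congr_int //.
move: (p - 5)`! => f; split=> [/dvdnP[m mE] | [k kE]].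
  have /inverse_mod24 mp : (m * p = 1 %[mod 24])%N by lia.
  have [k kE] : exists k : int, m%:Z = p%:Z + 24%:Z * k.
    (* The remainders of [m] and [p] agree, so [m - p] is 24 times the difference of the
       quotients. *)
    by exists ((m %/ 24)%:Z - (p %/ 24)%:Z); lia.
  by exists k; rewrite -kE; lia.
(* Divisibility in the integers is that of absolute values, so this is the goal up to conversion. *)
have : (p%:Z %| (24 * f).+1%:Z)%Z.
  by apply/dvdzP; exists (p%:Z + 24%:Z * k); lia.
by [].
Qed.
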